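(* Let $Q=(q_n)_{n\ge 1}$ be a fixed sequence of integers with $q_n>1$ for all $n$. For $x\in[0,1]$ write $x=\Delta^Q_{i_1i_2\ldots i_n\ldots}=\sum_{n=1}^{\infty}\frac{i_n}{q_1q_2\cdots q_n}$ with $i_n\in\{0,1,\ldots,q_n-1\}$, and let $\sigma_m$ ($m\ge1$) be the generalized shift operator and $\sigma=\sigma_1$ the shift operator, with compositions and iterates understood as described in the context. Then: (1) $\sigma\circ\sigma_2^m(x)=\sigma^{m+1}(x)$ for every positive integer $m$. (2) Suppose $(k_n)$ is a sequence of positive integers such that $k_n=k_{n-1}+1$ for $n=2,3,\ldots$. Then $\sigma^{k_1-1}\circ\sigma_{k_n}\circ\sigma_{k_{n-1}}\circ\cdots\circ\sigma_{k_1}(x)=\sigma^{k_n}(x)$ for every $n\ge 1$. (3) Suppose $k_1<k_2<\cdots<k_n$ is an arbitrary finite subsequence of the positive integers. Then $\sigma^{k_n-n}\circ\sigma_{k_n}\circ\sigma_{k_{n-1}}\circ\cdots\circ\sigma_{k_1}(x)=\sigma^{k_n}(x)$. (4) The mapping $\sigma_m$ is continuous at every $Q$-irrational point. At a $Q$-rational point $$x_0=\Delta^Q_{i_1i_2\ldots i_{n-1}i_n000\ldots}=\Delta^Q_{i_1i_2\ldots i_{n-1}[i_n-1][q_{n+1}-1][q_{n+2}-1][q_{n+3}-1]\ldots}\qquad (i_n\neq 0)$$ the mapping $\sigma_m$ is continuous whenever $m\neq n$; if $m=n$, then $x_0$ is a point of discontinuity of $\sigma_m$. (5) If $\sigma_m$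 has a derivative at the point $x=\Delta^Q_{i_1i_2\ldots i_n\ldots}$, then $(\sigma_m)'(x)=q_m$. (6) $x-\sigma_m(x)=\dfrac{i_m}{q_1q_2\cdots q_m}+\dfrac{\sigma^m(x)}{q_1q_2\cdots q_m}(1-q_m)$ for every $m\ge 1$.
   Context: Every $x\in[0,1]$ has an expansion $x=\Delta^Q_{i_1i_2\ldots}=\sum_{n\ge1}\frac{i_n}{q_1\cdots q_n}$, $i_n\in\{0,\ldots,q_n-1\}$ (positive Cantor series). Brackets such as $[i_n-1]$ denote a single digit. A number is called $Q$-rational if it has the form $\Delta^Q_{i_1\ldots i_{n-1}i_n000\ldots}=\Delta^Q_{i_1\ldots i_{n-1}[i_n-1][q_{n+1}-1][q_{n+2}-1]\ldots}$ with $i_n\ne0$; such numbers have exactly these two expansions. All other numbers of $[0,1]$ are called $Q$-irrational and have a unique expansion. Generalized shift operator: $\sigma_m$ deletes the $m$-th digit $i_m$ together with the $m$-th base element $q_m$, i.e. $$\sigma_m(x)=\sum_{k=1}^{m-1}\frac{i_k}{q_1q_2\cdots q_k}+\sum_{l=m+1}^{\infty}\frac{i_l}{q_1q_2\cdots q_{m-1}q_{m+1}\cdots q_l}.$$ Its value is a number represented by the two sequences $(q_1,\ldots,q_{m-1},q_{m+1},\ldots)$ and $(i_1,\ldots,i_{m-1},i_{m+1},\ldots)$. The shift operator is $\sigma=\sigma_1$, and its iterates are $\sigma^m(x)=\sum_{k=m+1}^{\infty}\frac{i_k}{q_{m+1}q_{m+2}\cdots q_k}$, $\sigma^0(x)=x$.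 Compositions: each operator is applied to the pair (base sequence, digit sequence) produced by the operators applied before it (rightmost first), and the number represented by the final pair is the value. Powers of $\sigma$ delete the currently first pairs (digit, base element), one for each factor $\sigma$. In (1), $\sigma_2^m$ is the $m$-fold iterate of $\sigma_2$, each application deleting the pair currently in second position. In (2) and (3), the indices $k_1,\ldots,k_n$ refer to the original numbering: $\sigma_{k_j}$ deletes the digit $i_{k_j}$ and the base element $q_{k_j}$ of the original sequences. When $x$ is $Q$-rational, one of its two expansions is fixed and used in the definition of $\sigma_m(x)$ and $\sigma^m(x)$ (the statements hold for any such choice). Continuity and differentiability refer to $\sigma_m$ as a real function on $[0,1]$ (one-sided at the endpoints). *)

(* Defs.v *)
From HB Require Import structures.
From mathcomp Require Import all_boot all_order all_algebra.
From mathcomp Require Import ring.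
From mathcomp Require Import all_classical all_reals all_analysis.
Import Order.TTheory GRing.Theory Num.Theory.
Import numFieldNormedType.Exports.

Set Implicit Arguments.
Unset Strict Implicit.
Unset Printing Implicit Defensive.

Local Open Scope classical_set_scope.
Local Open Scope ring_scope.

(* All sequences [nat -> _] are indexed from 1; their value at 0 is never
   used. *)

Definition Delta {R : realType} (q i : nat -> nat) : R :=
  limn (fun N : nat => \sum_(1 <= n < N)
    ((i n)%:R / \prod_(1 <= j < n.+1) (q j)%:R : R)).

Definition digits (q i : nat -> nat) : Prop :=
  forall n, (1 <= n)%N -> (i n < q n)%N.

Definition expansion {R : realType} (q : nat -> nat) (x : R) (i : nat -> nat) :
    Prop :=
  digits q i /\ x = Delta q i.

(* [sigma_at q i m] and [sigma_iter q i m] are the values of the generalized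
   shift and of the m-th power of the shift at the number with digits [i].
   Compositions are taken on (base, digit) pairs instead, see [delete];
   [value_delete] and [value_iter_delete1] relate the two. *)
Definition sigma_at {R : realType} (q i : nat -> nat) (m : nat) : R :=
  \sum_(1 <= k < m) ((i k)%:R / \prod_(1 <= j < k.+1) (q j)%:R) +
  limn (fun N : nat => \sum_(m.+1 <= l < N)
    ((i l)%:R /
      (\prod_(1 <= j < m) (q j)%:R * \prod_(m.+1 <= j < l.+1) (q j)%:R) : R)).

Definition sigma_iter {R : realType} (q i : nat -> nat) (m : nat) : R :=
  limn (fun N : nat => \sum_(m.+1 <= k < N)
    ((i k)%:R / \prod_(m.+1 <= j < k.+1) (q j)%:R : R)).

(* A pair (base sequence, digit sequence) is stored as one sequence of terms;
   [label] keeps the position the term had in the original sequences, which is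
   how the operators with indices in the original numbering find it. *)
Record term := Term { label : nat; base : nat; digit : nat }.

Definition terms (q i : nat -> nat) : nat -> term :=
  fun n => Term n (q n) (i n).

Definition value {R : realType} (s : nat -> term) : R :=
  Delta (fun n => base (s n)) (fun n => digit (s n)).

Definition delete (m : nat) (s : nat -> term) : nat -> term :=
  fun n => if (n < m)%N then s n else s n.+1.

(* Labels increase along every sequence obtained from [terms q i] by
   deletions.  Hence, when [k] labels a term that is still present, the terms
   before it keep their position and the later ones move one step forward. *)
Definition delete_label (k : nat) (s : nat -> term) : nat -> term :=
  fun n => if (label (s n) < k)%N then s n else s n.+1.

Definition delete_labels (k : nat -> nat) (n : nat) (s : nat -> term) :
    nat -> term :=
  foldl (fun t j => delete_label (k j) t) s (iota 1 n).

(* [x] has an expansion whose last nonzero digit has index [n]. *)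
Definition Qrational_at {R : realType} (q : nat -> nat) (n : nat) (x : R) :
    Prop :=
  exists i, [/\ expansion q x i, (1 <= n)%N, i n <> 0%N &
             forall k, (n < k)%N -> i k = 0%N].

Definition Qirrational {R : realType} (q : nat -> nat) (x : R) : Prop :=
  0 <= x <= 1 /\ ~ (exists n, Qrational_at q n x).

(* Both notions are relative to the domain [0, 1], so they are one-sided at
   the endpoints; values of [f] outside [0, 1] are irrelevant. *)
Definition continuous_on01_at {R : realType} (f : R -> R) (x : R) : Prop :=
  f @ within `[0, 1] (nbhs x) --> f x.

Definition derivative_on01_at {R : realType} (f : R -> R) (x l : R) : Prop :=
  (fun y => (f y - f x) / (y - x)) @ within `[0, 1] (x^') --> l.

Section Consistency.
Context {R : realType}.
Implicit Types (q i : nat -> nat) (s : nat -> term).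

Let part q i N : R :=
  \sum_(1 <= n < N) ((i n)%:R / \prod_(1 <= j < n.+1) (q j)%:R).

Let prod_gt0 q a N : (1 <= a)%N -> (forall n, (1 <= n)%N -> (0 < q n)%N) ->
  (0 : R) < \prod_(a <= j < N) (q j)%:R.
Proof.
move=> a1 q0; rewrite big_nat; apply: prodr_gt0 => j /andP[aj _].
by rewrite ltr0n q0 // (leq_trans a1).
Qed.

Lemma Delta_cvg q i : digits q i -> cvgn (part q i).
Proof.
move=> qi; have q0 n : (1 <= n)%N -> (0 < q n)%N.
  by move=> /qi; apply: leq_trans.
apply: nondecreasing_is_cvgn.
  apply/nondecreasing_seqP => -[|n]; first by rewrite /part !big_geq.
  rewrite /part [leRHS]big_nat_recr //= lerDl divr_ge0 //.
  exact/ltW/prod_gt0.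
have bd n : part q i n.+1 <= 1 - (\prod_(1 <= j < n.+1) (q j)%:R)^-1.
  elim: n => [|n IH]; first by rewrite /part !big_geq // invr1 subrr.
  rewrite /part big_nat_recr //= -/(part q i n.+1).
  have -> : \prod_(1 <= j < n.+2) (q j)%:R =
      \prod_(1 <= j < n.+1) (q j)%:R * (q n.+1)%:R :> R by rewrite big_nat_recr.
  have P0 : (0 : R) < \prod_(1 <= j < n.+1) (q j)%:R by exact: prod_gt0.
  have Q0 : (0 : R) < (q n.+1)%:R by rewrite ltr0n q0.
  apply: le_trans (lerD IH (lexx _)) _.
  set P := \prod_(_ <= _ < _) _ in P0 *.
  rewrite -addrA lerD2l -subr_ge0 opprD opprK.
  rewrite [X in 0 <= X](_ : _ = ((q n.+1)%:R - (i n.+1).+1%:R) / (P * (q n.+1)%:R)).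
    by rewrite divr_ge0 ?(ltW (mulr_gt0 P0 Q0)) // subr_ge0 ler_nat qi.
  by rewrite -natr1; field; rewrite !gt_eqF.
exists 1 => _ [[|n] _ <-]; first by rewrite /part big_geq.
apply: le_trans (bd n) _; rewrite gerBl invr_ge0; exact/ltW/prod_gt0.
Qed.

Lemma value_delete q i m : (1 <= m)%N -> digits q i ->
  value (delete m (terms q i)) = sigma_at q i m :> R.
Proof.
move=> m1 qi; rewrite /value /sigma_at.
set q' := fun n => base _; set i' := fun n => digit _.
have ltE n : (n < m)%N -> (q' n = q n) * (i' n = i n).
  by move=> nm; rewrite /q' /i' /delete nm.
have geE n : (m <= n)%N -> (q' n = q n.+1) * (i' n = i n.+1).
  by move=> mn; rewrite /q' /i' /delete ltnNge mn.
have qi' : digits q' i'.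
  move=> n n1; have [nm|mn] := ltnP n m; first by rewrite !ltE ?qi.
  by rewrite !geE ?qi.
have prE N : (m <= N)%N -> \prod_(1 <= j < N) (q' j)%:R =
    \prod_(1 <= j < m) (q j)%:R * \prod_(m.+1 <= j < N.+1) (q j)%:R :> R.
  move=> mN; rewrite (big_cat_nat m1 mN) //= (big_add1 _ _ m) /=; congr (_ * _).
    by apply: eq_big_nat => j /andP[_ jm]; rewrite ltE.
  by apply: eq_big_nat => j /andP[mj _]; rewrite geE.
set H := (X in _ = X + _); set T := (X in _ + lim (X @ _)).
have partE : \forall N \near \oo, part q' i' N - H = T N.+1.
  exists m => //= N /= mN; rewrite /part (big_cat_nat m1 mN) //=.
  rewrite /T (big_add1 _ _ m) /=.
  have <- : H =
     \sum_(1 <= n < m) ((i' n)%:R / \prod_(1 <= j < n.+1) (q' j)%:R).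
    apply: eq_big_nat => k /andP[_ km]; rewrite ltE //; congr (_ / _).
    by apply: eq_big_nat => j /andP[_ jk]; rewrite ltE // (leq_trans jk).
  rewrite addrAC subrr add0r; apply: eq_big_nat => l /andP[ml _].
  by rewrite geE // prE ?leqW.
have cT : T @ \oo --> Delta q' i' - H.
  rewrite -cvg_shiftS /=; apply: cvg_trans; first exact: near_eq_cvg partE.
  by apply: cvgB; [exact: Delta_cvg qi'|exact: cvg_cst].
by rewrite (cvg_lim _ cT) // addrC subrK.
Qed.

Lemma value_iter_delete1 q i m : digits q i ->
  value (iter m (delete 1) (terms q i)) = sigma_iter q i m :> R.
Proof.
move=> qi; rewrite /value.
have itE n : (1 <= n)%N -> iter m (delete 1) (terms q i) n =
    Term (n + m) (q (n + m)%N) (i (n + m)%N).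
  elim: m n => [|m IH] n n1; first by rewrite addn0.
  by rewrite iterS /delete ltnNge n1 /= IH // addSnnS.
set q' := fun n => base _; set i' := fun n => digit _.
have qi' : digits q' i' by move=> n n1; rewrite /q' /i' itE // qi // ltn_addr.
have c := @Delta_cvg _ _ qi'.
apply/esym/cvg_lim => //; rewrite -(cvg_shiftn m) /=.
apply: cvg_trans c; apply: near_eq_cvg; near=> N.
rewrite /part -[m.+1]/(1 + m)%N big_addn addnK.
apply: eq_big_nat => k /andP[k1 _]; rewrite /i' itE //=; congr (_ / _).
rewrite -addSn big_addn addnK.
by apply: eq_big_nat => j /andP[j1 _]; rewrite /q' itE.
Unshelve. all: by end_near.
Qed.

End Consistency.

(* Main.v *)
Require Import Defs.
From HB Require Import structures.
From mathcomp Require Import all_boot all_order all_algebra.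
From mathcomp Require Import all_classical all_reals all_analysis.
From mathcomp Require Import zify ring.
Import Order.TTheory GRing.Theory Num.Theory.
Import numFieldNormedType.Exports.
Set Implicit Arguments.
Unset Strict Implicit.
Unset Printing Implicit Defensive.
Local Open Scope classical_set_scope.
Local Open Scope ring_scope.

(** Write [P_m = q_1 ... q_m] and let [N] be the integer whose mixed-radix
digits are [i_1, ..., i_m], so that [x = (N + t) / P_m] with
[t = sigma^m (x)] in [[0, 1]].  Dividing [N] by [q_m] separates the [m]-th
digit (the remainder) from the earlier ones (the quotient), hence
[sigma_m (x) = (N / q_m + t) / P_(m-1)], where [N / q_m] is rounded down.  Both
formulas ([Delta_split], [sigma_at_split]) give [x - sigma_m (x)] by
subtraction.  Eliminating [t] gives
  [sigma_m (x) = q_m (x - s(N) / P_m)],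
where [s(N)] counts the integers in [1..N] that [q_m] does not divide
([sigma_at_branch]).  The only dependence on the digits is through [N], and
[N <= P_m x <= N + 1] determines [N] except when [P_m x] is an integer.

So [sigma_m] is affine of slope [q_m] inside each interval of rank [m], which
gives the derivative: every point of [[0, 1]] is approached from at least one
side along the interval [N] of its own digits.  At an integer [K = P_m x] the branches [K - 1]
and [K] meet, and they agree exactly when [s(K) = s(K - 1)], that is, when
[q_m] divides [K].  The points where [P_m x] is an integer not divisible by
[q_m] are exactly the [Q]-rational points whose last nonzero digit has index
[m] ([Qrational_atP]), and this index is determined by the point
([Qrational_at_inj]).  So they are the only points of discontinuity.

The identities between compositions hold term by term, at all indices [>= 1].
After deleting the labels [k_1 < ... < k_n], every term lying beyond the last
deleted one has moved by exactly [n] places ([delete_labelsE]); deleting the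
first [k_n - n] terms leaves only these. *)

(** * Prefixes of an expansion as integers *)

Definition weight (q : nat -> nat) (m : nat) : nat :=
  (\prod_(1 <= j < m.+1) q j)%N.

(** The integer with mixed-radix digits [i_1, ..., i_m], by Horner's scheme. *)
Fixpoint prefix_num (q i : nat -> nat) (m : nat) : nat :=
  if m is p.+1 then (prefix_num q i p * q m + i m)%N else 0%N.

Lemma weightS (q : nat -> nat) (m : nat) :
  weight q m.+1 = (weight q m * q m.+1)%N.
Proof. by rewrite /weight big_nat_recr. Qed.

Lemma weight_gt0 (q : nat -> nat) (m : nat) :
  (forall n, (1 <= n)%N -> (0 < q n)%N) -> (0 < weight q m)%N.
Proof.
move=> q0; elim: m => [|m IH]; first by rewrite /weight big_geq.
by rewrite weightS muln_gt0 IH q0.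
Qed.

Lemma natr_weight (R : realType) (q : nat -> nat) (m : nat) :
  \prod_(1 <= j < m.+1) (q j)%:R = (weight q m)%:R :> R.
Proof. by rewrite natr_prod. Qed.

Lemma digits_base_gt0 (q i : nat -> nat) :
  digits q i -> forall n, (1 <= n)%N -> (0 < q n)%N.
Proof. by move=> qi n /qi; apply: leq_trans. Qed.

Lemma prefix_num_lt (q i : nat -> nat) (m : nat) :
  digits q i -> (prefix_num q i m < weight q m)%N.
Proof.
move=> qi; elim: m => [|m IH]; first by rewrite /weight big_geq.
by rewrite weightS /=; have := qi m.+1 isT; nia.
Qed.

Lemma prefix_num_divn (q i : nat -> nat) (m : nat) :
  digits q i -> (prefix_num q i m.+1 %/ q m.+1)%N = prefix_num q i m.
Proof.
move=> qi; rewrite /= divnMDl ?(digits_base_gt0 qi) //.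
by rewrite divn_small ?addn0 // qi.
Qed.

Lemma prefix_num_modn (q i : nat -> nat) (m : nat) :
  digits q i -> (prefix_num q i m.+1 %% q m.+1)%N = i m.+1.
Proof. by move=> qi; rewrite /= modnMDl modn_small // qi. Qed.

Lemma partial_sum_prefix_num (R : realType) (q i : nat -> nat) (m : nat) :
  (forall n, (1 <= n)%N -> (0 < q n)%N) ->
  \sum_(1 <= n < m.+1) ((i n)%:R / \prod_(1 <= j < n.+1) (q j)%:R) =
    (prefix_num q i m)%:R / (weight q m)%:R :> R.
Proof.
move=> q0; elim: m => [|m IH]; first by rewrite big_geq // mul0r.
have W0 : (weight q m)%:R != 0 :> R by rewrite pnatr_eq0 -lt0n weight_gt0.
have Q0 : (q m.+1)%:R != 0 :> R by rewrite pnatr_eq0 -lt0n q0.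
rewrite big_nat_recr //= IH natr_weight weightS natrD !natrM.
by field; rewrite ?W0 ?Q0.
Qed.

(** * Splitting an expansion after a prefix *)

(** The partial sums are [N / P_m] with [N < P_m]. *)
Lemma Delta_itv (R : realType) (q i : nat -> nat) :
  digits q i -> 0 <= (Delta q i : R) <= 1.
Proof.
move=> qi; have q0 := digits_base_gt0 qi.
apply/andP; split; [apply: limr_ge|apply: limr_le]; try exact: Delta_cvg.
  by apply: nearW => N; apply: sumr_ge0 => n _; rewrite divr_ge0 // prodr_ge0.
exists 1%N => // -[|m] _ //=; rewrite partial_sum_prefix_num //.
rewrite ler_pdivrMr ?ltr0n ?weight_gt0 // mul1r ler_nat ltnW //.
exact: prefix_num_lt.
Qed.

Lemma digits_shift (q i : nat -> nat) (m : nat) :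
  digits q i -> digits (fun n => q (n + m)%N) (fun n => i (n + m)%N).
Proof. by move=> qi n n1; apply: qi; rewrite ltn_addr. Qed.

Lemma tail_cvg (R : realType) (q i : nat -> nat) (m : nat) : digits q i ->
  (fun N => \sum_(m.+1 <= k < N)
     ((i k)%:R / \prod_(m.+1 <= j < k.+1) (q j)%:R) : R) @ \oo -->
  (Delta (fun n => q (n + m)%N) (fun n => i (n + m)%N) : R).
Proof.
move=> /(@digits_shift _ _ m) /(@Delta_cvg R) c.
rewrite -(cvg_shiftn m); apply: cvg_trans c; apply: near_eq_cvg.
apply: nearW => N /=; rewrite -[m.+1]/(1 + m)%N big_addn addnK.
apply: eq_bigr => k _; congr (_ / _).
by rewrite -addSn big_addn addnK.
Qed.

Lemma sigma_iterE (R : realType) (q i : nat -> nat) (m : nat) : digits q i ->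
  sigma_iter q i m = Delta (fun n => q (n + m)%N) (fun n => i (n + m)%N) :> R.
Proof. by move=> qi; apply/cvg_lim => //; apply: tail_cvg. Qed.

Lemma sigma_iter_itv (R : realType) (q i : nat -> nat) (m : nat) :
  digits q i -> 0 <= (sigma_iter q i m : R) <= 1.
Proof. by move=> qi; rewrite sigma_iterE //; apply/Delta_itv/digits_shift. Qed.

Lemma sigma_iter_finite (R : realType) (q i : nat -> nat) (m : nat) :
  (forall k, (m < k)%N -> i k = 0%N) -> sigma_iter q i m = 0 :> R.
Proof.
move=> i0; apply/cvg_lim => //; apply: cvg_near_cst; apply: nearW => N.
by rewrite big_nat big1 // => k /andP[/i0 -> _]; rewrite mul0r.
Qed.

Lemma Delta_split (R : realType) (q i : nat -> nat) (m : nat) : digits q i ->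
  Delta q i = ((prefix_num q i m)%:R + sigma_iter q i m) / (weight q m)%:R :> R.
Proof.
move=> qi; apply/cvg_lim => //.
rewrite mulrDl -partial_sum_prefix_num; last exact: digits_base_gt0 qi.
rewrite sigma_iterE // -natr_weight.
set H := \sum_(1 <= n < _) _; set W := \prod_(1 <= j < _) _.
have := @tail_cvg R q i m qi.
move=> /cvgM /(_ (@cvg_cst _ W^-1 _ _ _)) /(cvgD (@cvg_cst _ H _ _ _)) c.
apply: cvg_trans c; apply: near_eq_cvg; exists m.+1 => // N /= mN.
rewrite [RHS](@big_cat_nat _ _ _ m.+1) //=; congr (_ + _).
rewrite /= mulr_suml; apply: eq_big_nat => k /andP[mk _] /=.
have -> : \prod_(1 <= j < k.+1) (q j)%:R =
    W * \prod_(m.+1 <= j < k.+1) (q j)%:R :> R.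
  by rewrite (@big_cat_nat _ _ _ m.+1) // leqW.
by rewrite invfM mulrA mulrAC.
Qed.

Lemma sigma_at_split (R : realType) (q i : nat -> nat) (m : nat) : digits q i ->
  sigma_at q i m.+1 =
    ((prefix_num q i m)%:R + sigma_iter q i m.+1) / (weight q m)%:R :> R.
Proof.
move=> qi; have q0 := digits_base_gt0 qi.
rewrite /sigma_at partial_sum_prefix_num //.
rewrite mulrDl; congr (_ + _); apply/cvg_lim => //.
rewrite sigma_iterE // -natr_weight; set W := \prod_(1 <= j < _) _.
have := @tail_cvg R q i m.+1 qi; move=> /cvgM /(_ (@cvg_cst _ W^-1 _ _ _)) c.
apply: cvg_trans c; apply: near_eq_cvg; apply: nearW => N /=.
rewrite mulr_suml; apply: eq_bigr => k _ /=.
by rewrite invfM mulrA mulrAC.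
Qed.

(** * The shift as a piecewise affine function *)

(** The number of integers in [1..N] that are not multiples of [b]. *)
Definition skip (b N : nat) : nat := (N - N %/ b)%N.

Lemma skipS (b N : nat) : (0 < b)%N ->
  skip b N.+1 = (skip b N + ~~ (b %| N.+1)%N)%N.
Proof.
move=> b0; rewrite /skip divnS //; have := leq_div N b.
by case: (b %| N.+1)%N => /=; lia.
Qed.

(** The affine function with which [sigma_m] coincides on the numbers whose
first [m] digits have mixed-radix value [N]. *)
Definition branch {R : realType} (q : nat -> nat) (m N : nat) (x : R) : R :=
  (q m)%:R * (x - (skip (q m) N)%:R / (weight q m)%:R).

Lemma branch_continuous (R : realType) (q : nat -> nat) (m N : nat) :
  continuous (@branch R q m N).
Proof.
move=> x; apply: cvgM; first exact: cvg_cst.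
by apply: cvgB; [exact: cvg_id|exact: cvg_cst].
Qed.

Lemma prefix_num_bracket (R : realType) (q i : nat -> nat) (m : nat) (x : R) :
  expansion q x i ->
  (prefix_num q i m)%:R <= x * (weight q m)%:R <= (prefix_num q i m).+1%:R.
Proof.
move=> [qi ->]; have W0 : (weight q m)%:R != 0 :> R.
  by rewrite pnatr_eq0 -lt0n weight_gt0 //; exact: digits_base_gt0 qi.
rewrite (Delta_split R m qi) divfK // -natr1.
by have /andP[t0 t1] := sigma_iter_itv R m qi; rewrite lerDl t0 lerD2l.
Qed.

(** Substituting [t = P_m x - N] in [sigma_m (x) = (N / q_m + t) / P_(m-1)]. *)
Lemma sigma_at_branch (R : realType) (q i : nat -> nat) (m : nat) (x : R) :
  expansion q x i -> (1 <= m)%N ->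
  sigma_at q i m = branch q m (prefix_num q i m) x.
Proof.
move=> [qi ->]; case: m => // m _; have q0 := digits_base_gt0 qi.
have W0 : (weight q m)%:R != 0 :> R by rewrite pnatr_eq0 -lt0n weight_gt0.
have Q0 : (q m.+1)%:R != 0 :> R by rewrite pnatr_eq0 -lt0n q0.
rewrite (sigma_at_split R m qi) (Delta_split R m.+1 qi) /branch /skip.
rewrite natrB ?leq_div // prefix_num_divn // weightS natrM.
by field; rewrite ?W0 ?Q0.
Qed.

(** Off the endpoints of the intervals of rank [m], the position of [x] alone
determines its first [m] digits. *)
Lemma sigma_at_between (R : realType) (q i : nat -> nat) (m N : nat) (x : R) :
  expansion q x i -> (1 <= m)%N ->
  N%:R < x * (weight q m)%:R < N.+1%:R ->
  sigma_at q i m = branch q m N x.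
Proof.
move=> xi m1 /andP[Nx xN]; rewrite (sigma_at_branch xi m1).
have /andP[cx xc] := prefix_num_bracket m xi; congr branch.
have := le_lt_trans cx xN; have := lt_le_trans Nx xc.
by rewrite !ltr_nat; lia.
Qed.

(** * Rational points *)

Lemma prefix_num_surj (q : nat -> nat) (m K : nat) :
  (forall n, (1 <= n)%N -> (0 < q n)%N) -> (K < weight q m)%N ->
  exists i, [/\ digits q i, prefix_num q i m = K &
                forall n, (m < n)%N -> i n = 0%N].
Proof.
move=> q0; elim: m K => [|m IH] K KW.
  exists (fun=> 0%N); split => //.
  by move: KW; rewrite /weight big_geq //=; case: K.
have /IH[i [qi iK i0]] : (K %/ q m.+1 < weight q m)%N.
  by rewrite ltn_divLR ?q0 // -weightS.
exists (fun n => if n == m.+1 then (K %% q m.+1)%N else i n); split.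
- by move=> n n1; case: eqP => [->|_]; [rewrite ltn_mod q0|exact: qi].
- rewrite /= eqxx [X in (X * _ + _)%N](_ : _ = (K %/ q m.+1)%N) -?divn_eq //.
  rewrite -{}iK; have : (m < m.+1)%N by [].
  (* The digit changed at index [m.+1] is not read by the prefix of length [m];
     the index is generalized to allow an induction on [m]. *)
  move: {-1}m.+1 => p; elim: m {IH KW qi i0} => //= m IH mp.
  by rewrite IH ?ltn_eqF // ltnW.
- by move=> n mn; rewrite gtn_eqF // i0 // ltnW.
Qed.

(** A finite expansion of length [m] is an integer over [P_m], and its last
digit is the remainder of that integer modulo [q_m]. *)
Lemma Qrational_atP (R : realType) (q : nat -> nat) (m : nat) (x : R) :
  (forall n, (1 <= n)%N -> (1 < q n)%N) -> (1 <= m)%N ->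
  Qrational_at q m x <->
  exists K : nat, [/\ (K < weight q m)%N, ~~ (q m %| K)%N &
                      x * (weight q m)%:R = K%:R].
Proof.
move=> hq; case: m => // m _.
have q0 n : (1 <= n)%N -> (0 < q n)%N by move=> /hq /ltnW.
have W0 : (weight q m.+1)%:R != 0 :> R by rewrite pnatr_eq0 -lt0n weight_gt0.
split=> [[i [[qi xi] _ im i0]]|[K [KW qK xK]]].
  exists (prefix_num q i m.+1); split; first exact: prefix_num_lt.
    by rewrite /dvdn prefix_num_modn //; apply/eqP.
  by rewrite xi (Delta_split R m.+1 qi) sigma_iter_finite // addr0 divfK.
have [i [qi iK i0]] := prefix_num_surj q0 KW.
have im : i m.+1 <> 0%N.
  by move: qK; rewrite /dvdn -iK prefix_num_modn // => /eqP.
exists i; split=> //; split=> //; rewrite (Delta_split R m.+1 qi).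
by rewrite sigma_iter_finite // addr0 iK -xK mulfK.
Qed.

Lemma Qrational_at_itv (R : realType) (q : nat -> nat) (n : nat) (x : R) :
  Qrational_at q n x -> 0 <= x <= 1.
Proof. by case=> i [[qi ->] _ _ _]; exact: Delta_itv. Qed.

Lemma weight_dvd (q : nat -> nat) (m n : nat) : (n <= m)%N ->
  (weight q n %| weight q m)%N.
Proof.
move=> nm; rewrite /weight (@big_cat_nat _ _ _ n.+1 1 m.+1) //=.
exact: dvdn_mulr.
Qed.

(** If the expansion of [x] stops at [n < m], then [P_m x] is the product of the
integer [P_n x] and [q_(n+1) ... q_m], hence a multiple of [q_m]. *)
Lemma Qrational_at_inj (R : realType) (q : nat -> nat) (m n : nat) (x : R) :
  (forall n, (1 <= n)%N -> (1 < q n)%N) ->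
  Qrational_at q m x -> Qrational_at q n x -> m = n.
Proof.
move=> hq; wlog nm : m n / (n <= m)%N => [H xm xn|xm xn].
  by case/orP: (leq_total n m) => ?; [|apply/esym]; apply: H.
apply/eqP; rewrite eqn_leq nm andbT leqNgt; apply/negP => ltnm.
have m1 : (1 <= m)%N by case: xm => ? [].
have n1 : (1 <= n)%N by case: xn => ? [].
have /(Qrational_atP x hq m1)[K [_ + xK]] := xm.
have /(Qrational_atP x hq n1)[L [_ _ xL]] := xn.
case: m m1 {nm} ltnm xK {xm} => // m _; rewrite ltnS => nm.
have /dvdnP[c Wc] := weight_dvd q nm.
move=> xK /negP; apply; move: xK; rewrite weightS Wc natrM natrM.
rewrite [_ * (weight q n)%:R]mulrC -mulrA mulrA xL -!natrM => /eqP.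
by rewrite eqr_nat => /eqP <-; rewrite !dvdn_mull.
Qed.

(** * Continuity and derivative *)

Lemma cvg_to_within (T : topologicalType) (F G : set_system T) (D : set T) :
  Filter F -> Filter G -> G --> F -> (\forall y \near G, D y) ->
  G --> within D F.
Proof.
move=> FF FG GF GD P FP; apply: filterS2 GD (GF _ FP) => y Dy; exact.
Qed.

Section Shift.
Context (R : realType) (q : nat -> nat) (d : R -> nat -> nat) (m : nat).
Hypothesis hq : forall n, (1 <= n)%N -> (1 < q n)%N.
Hypothesis hd : forall x : R, 0 <= x <= 1 -> expansion q x (d x).
Hypothesis m1 : (1 <= m)%N.

Let W : R := (weight q m)%:R.
Let f (y : R) : R := sigma_at q (d y) m.

Let q0 n : (1 <= n)%N -> (0 < q n)%N.
Proof. by move=> /hq /ltnW. Qed.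

Let W0 : 0 < W.
Proof. by rewrite ltr0n weight_gt0. Qed.

Let mulW_cvg (x : R) : y * W @[y --> x] --> x * W.
Proof. by apply: cvgM; [exact: cvg_id|exact: cvg_cst]. Qed.

Let near_between (x a b : R) : a < x * W < b ->
  \forall y \near x, a < y * W < b.
Proof.
move=> /andP[ax xb]; near=> y; apply/andP; split; near: y.
  exact: (cvgr_gt _ (@mulW_cvg x)).
exact: (cvgr_lt _ (@mulW_cvg x)).
Unshelve. all: by end_near.
Qed.

Let between01 (N : nat) (y : R) : (N < weight q m)%N ->
  N%:R < y * W < N.+1%:R -> 0 < y < 1.
Proof.
move=> NW /andP[Ny yN]; rewrite -(pmulr_lgt0 _ W0) (le_lt_trans _ Ny) //=.
by rewrite -(ltr_pM2r W0) mul1r (lt_le_trans yN) // ler_nat.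
Qed.

Let right_branch (N : nat) (x : R) : (N < weight q m)%N ->
  N%:R <= x * W < N.+1%:R ->
  \forall y \near x^'+, 0 <= y <= 1 /\ f y = branch q m N y.
Proof.
move=> NW /andP[Nx xN].
have c : y * W @[y --> x^'+] --> x * W.
  by apply: cvg_within_filter; exact: mulW_cvg.
near=> y; have yN : N%:R < y * W < N.+1%:R.
  apply/andP; split.
    by rewrite (le_lt_trans Nx) // ltr_pM2r //; near: y; exact: nbhs_right_gt.
  by near: y; apply: (cvgr_lt _ c).
have /andP[/ltW y0 /ltW y1] := between01 NW yN.
have y01 : 0 <= y <= 1 by rewrite y0.
by split=> //; apply: sigma_at_between (hd y01) m1 yN.
Unshelve. all: by end_near.
Qed.

Let left_branch (N : nat) (x : R) : (N < weight q m)%N ->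
  N%:R < x * W <= N.+1%:R ->
  \forall y \near x^'-, 0 <= y <= 1 /\ f y = branch q m N y.
Proof.
move=> NW /andP[Nx xN].
have c : y * W @[y --> x^'-] --> x * W.
  by apply: cvg_within_filter; exact: mulW_cvg.
near=> y; have yN : N%:R < y * W < N.+1%:R.
  apply/andP; split; first by near: y; apply: (cvgr_gt _ c).
  by rewrite (lt_le_trans _ xN) // ltr_pM2r //; near: y; exact: nbhs_left_lt.
have /andP[/ltW y0 /ltW y1] := between01 NW yN.
have y01 : 0 <= y <= 1 by rewrite y0.
by split=> //; apply: sigma_at_between (hd y01) m1 yN.
Unshelve. all: by end_near.
Qed.

(** Near [x] only the branch of [K], the integer part of [P_m x], occurs, except
that [K - 1] may also occur when [P_m x = K]; then [q_m] divides [K], so the two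
branches are the same function.  This includes the endpoints, where [K] is [0]
or [P_m]. *)
Lemma continuous_sigma_at (x : R) : 0 <= x <= 1 -> ~ Qrational_at q m x ->
  continuous_on01_at f x.
Proof.
move=> x01 xq; have /andP[x0 x1] := x01.
have /truncn_itv/andP[Kx xK] : 0 <= x * W by rewrite mulr_ge0 // ltW.
set K := Num.truncn _ in Kx xK.
have skipK : \forall y \near x, forall N : nat,
    N%:R <= y * W <= N.+1%:R -> skip (q m) N = skip (q m) K.
  move: Kx; rewrite le_eqVlt => /predU1P[KE|Kx].
    have qK : (q m %| K)%N.
      have : K%:R <= W by rewrite KE ler_piMl // ltW.
      rewrite ler_nat leq_eqVlt => /predU1P[->|KW].
        by case: (m) m1 => // p _; rewrite weightS dvdn_mull.
      by apply: contraPT xq => qK; apply; apply/Qrational_atP => //; exists K.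
    have : K%:R - 1 < x * W < K.+1%:R.
      by rewrite -KE ltr_nat leqnn gtrBl ltr01.
    move=> /near_between; apply: filterS => y /andP[Ky yK] N /andP[Ny yN].
    have NK : (N < K.+1)%N by rewrite -(ltr_nat R) (le_lt_trans Ny).
    have KN : (K < N.+2)%N.
      rewrite -(ltr_nat R) -[N.+2%:R]natr1 -ltrBlDr.
      exact: lt_le_trans Ky yN.
    have [->//|NE] : N = K \/ N.+1 = K by lia.
    by rewrite -NE skipS ?q0 // NE qK addn0.
  have : K%:R < x * W < K.+1%:R by rewrite Kx.
  move=> /near_between; apply: filterS => y /andP[Ky yK] N /andP[Ny yN].
  have NK : (N < K.+1)%N by rewrite -(ltr_nat R) (le_lt_trans Ny).
  have KN : (K < N.+1)%N by rewrite -(ltr_nat R) (lt_le_trans Ky).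
  by congr skip; lia.
have fE : \forall y \near x, 0 <= y <= 1 -> branch q m K y = f y.
  apply: filterS skipK => y sK y01.
  rewrite /f (sigma_at_branch (hd y01) m1) /branch.
  rewrite (sK (prefix_num q (d y) m)) //.
  exact: prefix_num_bracket (hd y01).
rewrite /continuous_on01_at -(nbhs_singleton fE x01).
apply: (@cvg_trans _ (branch q m K @ within `[0, 1] (nbhs x))).
  apply: near_eq_cvg; apply: filterS fE => y fE; rewrite /= in_itv; exact: fE.
by apply: cvg_within_filter; exact: branch_continuous.
Qed.

(** The one-sided limits at [x] are those of the branches [K] and [K - 1], where
[K = P_m x] is not a multiple of [q_m]; continuity would force both to equal
[sigma_m (x)], but these branches differ by a nonzero constant. *)
Lemma discontinuous_sigma_at (x : R) : Qrational_at q m x ->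
  ~ continuous_on01_at f x.
Proof.
move=> /(Qrational_atP x hq m1)[K [KW qK xK]] fc.
case: K KW qK xK => [|K] KW qK xK; first by rewrite dvdn0 in qK.
have lim1 (N : nat) (G : set_system R) : ProperFilter G -> G --> x ->
    (\forall y \near G, 0 <= y <= 1 /\ f y = branch q m N y) ->
    f x = branch q m N x.
  move=> PG Gx GN; apply: (@cvg_unique _ _ (f @ G)) => //=.
  - apply: cvg_trans fc; apply: cvg_app; apply: cvg_to_within => //.
    by apply: filterS GN => y []; rewrite /= in_itv.
  - have : branch q m N @ G --> branch q m N x.
      exact: cvg_trans (cvg_app _ Gx) (@branch_continuous R q m N x).
    by apply: cvg_trans; apply: near_eq_cvg; apply: filterS GN => y [].
have fr : f x = branch q m K.+1 x.
  apply: (lim1 K.+1 x^'+); first exact: cvg_within.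
  by apply: right_branch => //; rewrite [x * W]xK lexx ltr_nat /=.
have fl : f x = branch q m K x.
  apply: (lim1 K x^'-); first exact: cvg_within.
  by apply: left_branch; rewrite ?(ltnW KW) // [x * W]xK lexx ltr_nat leqnn.
have Q0 : (q m)%:R != 0 :> R by rewrite pnatr_eq0 -lt0n q0.
move: fr; rewrite fl => /(mulfI Q0)/addrI/oppr_inj/(divIf (lt0r_neq0 W0))/eqP.
by rewrite eqr_nat skipS ?q0 // qK; lia.
Qed.

(** The interval [[N / P_m, (N + 1) / P_m]] of the digits of [x] extends to the
right or to the left of [x]; on that side the difference quotient is constant,
equal to [q_m]. *)
Lemma derivative_sigma_at (x l : R) : 0 <= x <= 1 ->
  derivative_on01_at f x l -> l = (q m)%:R.
Proof.
move=> x01 fl; set N := prefix_num q (d x) m.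
have /andP[Nx xN] := prefix_num_bracket m (hd x01).
have NW : (N < weight q m)%N by apply: prefix_num_lt; case: (hd x01).
have fx : f x = branch q m N x by apply: sigma_at_branch => //; exact: hd.
have lim1 (G : set_system R) : ProperFilter G -> G --> x^' ->
    (\forall y \near G, 0 <= y <= 1 /\ f y = branch q m N y) ->
    l = (q m)%:R.
  move=> PG Gx GN; pose slope y := (f y - f x) / (y - x).
  apply: (@cvg_unique _ _ (slope @ G)) => //=.
  - apply: cvg_trans fl; apply: cvg_app; apply: cvg_to_within => //.
    by apply: filterS GN => y []; rewrite /= in_itv.
  - apply: cvg_near_cst.
    have Gneq : \forall y \near G, y != x := Gx _ (nbhs_dnbhs_neq x).
    apply: filterS2 GN Gneq => y [_ fy] yx.
    have yx0 : y - x != 0 by rewrite subr_eq0.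
    rewrite /slope fy fx /branch -mulrBr opprD opprK addrACA addNr addr0.
    exact: mulfK.
have [xlt|] := ltP (x * W) N.+1%:R.
  apply: (lim1 x^'+).
    apply: cvg_to_within; first exact: cvg_within.
    by near=> y; rewrite gt_eqF //; near: y; exact: nbhs_right_gt.
  by apply: right_branch => //; rewrite Nx.
move=> xge; apply: (lim1 x^'-).
  apply: cvg_to_within; first exact: cvg_within.
  by near=> y; rewrite lt_eqF //; near: y; exact: nbhs_left_lt.
by apply: left_branch => //; rewrite xN (lt_le_trans _ xge) // ltr_nat.
Unshelve. all: by end_near.
Qed.

End Shift.

(** * Compositions of deletions *)

Lemma eq_value (R : realType) (s t : nat -> term) :
  (forall n, (1 <= n)%N -> s n = t n) -> value s = value t :> R.
Proof.
move=> st; rewrite /value /Delta; congr (limn _); apply/funext => N.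
apply: eq_big_nat => n /andP[n1 _]; rewrite st //; congr (_ / _).
by apply: eq_big_nat => j /andP[j1 _]; rewrite st.
Qed.

Lemma iter_delete1 (s : nat -> term) (p n : nat) : (1 <= n)%N ->
  iter p (delete 1) s n = s (n + p)%N.
Proof.
elim: p n => [|p IH] n n1; first by rewrite addn0.
by rewrite iterS /delete ltnNge n1 /= IH // addSnnS.
Qed.

Lemma iter_delete2 (s : nat -> term) (p n : nat) : (2 <= n)%N ->
  iter p (delete 2) s n = s (n + p)%N.
Proof.
elim: p n => [|p IH] n n2; first by rewrite addn0.
by rewrite iterS /delete ltnNge n2 /= IH 1?ltnW // addSnnS.
Qed.

Lemma delete_labelsS (k : nat -> nat) (n : nat) (s : nat -> term) :
  delete_labels k n.+1 s = delete_label (k n.+1) (delete_labels k n s).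
Proof. by rewrite /delete_labels -[n.+1]addn1 iotaD foldl_cat add1n addn1. Qed.

(** The positions [p] with [k n < p + n] are those past the last deletion.  For
the [n]-th deletion, such a position holds a term with label [p + n - 1 >= k n],
so the deletion moves it. *)
Lemma delete_labelsE (q i k : nat -> nat) (n p : nat) :
  (forall j, (1 <= j < n)%N -> (k j < k j.+1)%N) ->
  (1 <= n)%N -> (k n < p + n)%N ->
  delete_labels k n (terms q i) p = terms q i (p + n)%N.
Proof.
case: n => // n + _; elim: n p => [|n IH] p kS kp.
  rewrite /delete_labels /= /delete_label /terms /= addn1 ifN // -leqNgt.
  by move: kp; rewrite addn1.
have kn : (k n.+1 < k n.+2)%N by apply: kS; rewrite /= ltnS.
rewrite delete_labelsS /delete_label !IH; try by lia.
- by rewrite /= ifN -?leqNgt ?addSnnS ?addn1 //; lia.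
- by move=> j /andP[j1 jn]; apply: kS; rewrite j1 ltnS ltnW.
- by move=> j /andP[j1 jn]; apply: kS; rewrite j1 ltnS ltnW.
Qed.

(** This makes [k n - n], the number of terms left before the last deleted one,
an exact subtraction. *)
Lemma increasing_ge (k : nat -> nat) (n : nat) : (1 <= n)%N ->
  (0 < k 1)%N -> (forall j, (1 <= j < n)%N -> (k j < k j.+1)%N) ->
  (n <= k n)%N.
Proof.
case: n => // n _ k1; elim: n => // n IH kS.
have : (n.+1 <= k n.+1)%N.
  by apply: IH => j /andP[j1 jn]; apply: kS; rewrite j1 ltnS ltnW.
by move=> nk; rewrite (leq_ltn_trans nk) // kS /=.
Qed.

Lemma value_delete_labels (R : realType) (q i k : nat -> nat) (n : nat) :
  digits q i -> (1 <= n)%N -> (0 < k 1)%N ->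
  (forall j, (1 <= j < n)%N -> (k j < k j.+1)%N) ->
  value (iter (k n - n) (delete 1) (delete_labels k n (terms q i))) =
    sigma_iter q i (k n) :> R.
Proof.
move=> qi n1 k1 kS; have nk := increasing_ge n1 k1 kS.
rewrite -value_iter_delete1 //; apply: eq_value => p p1.
rewrite !iter_delete1 // delete_labelsE //; last by lia.
by congr terms; lia.
Qed.

Theorem mainTheorem1 (R : realType) (q : nat -> nat)
    (hq : forall n, (1 <= n)%N -> (1 < q n)%N)
    (d : R -> nat -> nat)
    (hd : forall x : R, 0 <= x <= 1 -> expansion q x (d x)) :
  (* (1) *)
  (forall (x : R) (m : nat), 0 <= x <= 1 -> (1 <= m)%N ->
    value (delete 1 (iter m (delete 2) (terms q (d x)))) =
      sigma_iter q (d x) m.+1 :> R) /\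
  (* (2) *)
  (forall (x : R) (k : nat -> nat), 0 <= x <= 1 ->
    (forall n, (1 <= n)%N -> (0 < k n)%N) ->
    (forall n, (2 <= n)%N -> k n = (k n.-1 + 1)%N) ->
    forall n, (1 <= n)%N ->
      value (iter (k 1%N - 1) (delete 1)
        (delete_labels k n (terms q (d x)))) = sigma_iter q (d x) (k n) :> R) /\
  (* (3) *)
  (forall (x : R) (n : nat) (k : nat -> nat), 0 <= x <= 1 -> (1 <= n)%N ->
    (forall j, (1 <= j <= n)%N -> (0 < k j)%N) ->
    (forall j, (1 <= j < n)%N -> (k j < k j.+1)%N) ->
    value (iter (k n - n) (delete 1)
      (delete_labels k n (terms q (d x)))) = sigma_iter q (d x) (k n) :> R) /\
  (* (4) *)
  (forall m : nat, (1 <= m)%N ->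
    (forall x : R, Qirrational q x ->
      continuous_on01_at (fun y => sigma_at q (d y) m) x) /\
    (forall (x0 : R) (n : nat), Qrational_at q n x0 ->
      (m <> n -> continuous_on01_at (fun y => sigma_at q (d y) m) x0) /\
      (m = n -> ~ continuous_on01_at (fun y => sigma_at q (d y) m) x0))) /\
  (* (5) *)
  (forall (m : nat) (x l : R), (1 <= m)%N -> 0 <= x <= 1 ->
    derivative_on01_at (fun y => sigma_at q (d y) m) x l -> l = (q m)%:R) /\
  (* (6) *)
  (forall (x : R) (m : nat), 0 <= x <= 1 -> (1 <= m)%N ->
    x - sigma_at q (d x) m =
      (d x m)%:R / \prod_(1 <= j < m.+1) (q j)%:R +
      sigma_iter q (d x) m / \prod_(1 <= j < m.+1) (q j)%:R * (1 - (q m)%:R)).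

Proof.
have dP (x : R) : 0 <= x <= 1 -> digits q (d x) by move=> /hd [].
split; [|split; [|split; [|split; [|split]]]].
- move=> x m x01 _; rewrite -value_iter_delete1; last exact: dP.
  apply: eq_value => n n1; rewrite iter_delete1 // /delete ltnNge n1 /=.
  by rewrite iter_delete2 // addSnnS.
- move=> x k x01 k0 kS n n1.
  have kE : k n = (k 1%N + n.-1)%N.
    case: n n1 => // n _; elim: n => [|n IH]; first by rewrite addn0.
    by rewrite kS //= IH addn1 addnS.
  (* Consecutive labels: as many terms precede the last deleted one after the
     deletions as preceded the first one before them. *)
  have <- : (k n - n = k 1 - 1)%N by have := k0 1%N isT; lia.
  apply: value_delete_labels => //; [exact: dP|exact: k0|].
  by move=> j /andP[j1 _]; rewrite (kS j.+1) ?ltnS //= addn1.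
- move=> x n k x01 n1 k0 kS; apply: value_delete_labels => //; first exact: dP.
  by apply: k0; rewrite n1.
- move=> m m1; split=> [x [x01 xq]|x n xn].
    by apply: continuous_sigma_at => // xm; apply: xq; exists m.
  split=> [mn|mn]; last by apply: discontinuous_sigma_at; rewrite // mn.
  apply: continuous_sigma_at => // [|xm]; first exact: Qrational_at_itv xn.
  by apply: mn; apply: Qrational_at_inj xm xn.
- by move=> m x l m1 x01; apply: derivative_sigma_at.
- move=> x m x01 m1; have [qi xE] := hd x x01.
  case: m m1 => // m _; have q0 := digits_base_gt0 qi.
  have W0 : (weight q m)%:R != 0 :> R by rewrite pnatr_eq0 -lt0n weight_gt0.
  have Q0 : (q m.+1)%:R != 0 :> R by rewrite pnatr_eq0 -lt0n q0.
  rewrite [x in x - _]xE (Delta_split R m.+1 qi) (sigma_at_split R m qi).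
  rewrite natr_weight weightS /= natrD !natrM.
  by field; rewrite ?W0 ?Q0.
Qed.
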